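(* Let $v \geq 7$ be an odd integer. If there exists a $\mathrm{TTS}(v)$ with a Hamiltonian $2$-BIG, then there exists a $\mathrm{TTS}(3v+1)$ with a Hamiltonian $2$-BIG.
   Context: A twofold triple system of order $v$, denoted $\mathrm{TTS}(v)$, is a pair $(V,\mathcal{B})$ where $V$ is a set of $v$ points and $\mathcal{B}$ is a collection of $3$-element subsets of $V$ (called blocks or triples; repeated blocks are permitted, i.e. $\mathcal{B}$ is a multiset) such that each $2$-element subset of $V$ is contained in exactly two blocks of $\mathcal{B}$, counted with multiplicity. The $2$-block-intersection graph ($2$-BIG) of $(V,\mathcal{B})$ is the graph whose vertices are the blocks in $\mathcal{B}$ (repeated blocks giving distinct vertices), where two vertices $B_1,B_2$ are adjacent if and only if $|B_1\cap B_2|=2$. A graph is Hamiltonian if it contains a Hamilton cycle (a cycle, of length at least $3$, through all vertices). *)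

(* Defs.v *)
From mathcomp Require Import all_boot.

Set Implicit Arguments.
Unset Strict Implicit.
Unset Printing Implicit Defensive.

(* Blocks are listed in a sequence, so repeated blocks are allowed and [count]
   counts them with multiplicity. *)
Definition is_TTS (v : nat) (V : finType) (B : seq {set V}) : Prop :=
  [/\ #|V| = v,
      forall b : {set V}, b \in B -> #|b| = 3
    & forall P : {set V}, #|P| = 2 -> count (fun b : {set V} => P \subset b) B = 2].

(* The vertices are the positions in B, so that repeated blocks give distinct
   vertices. *)
Definition two_BIG (V : finType) (B : seq {set V}) : rel 'I_(size B) :=
  fun i j => #|tnth (in_tuple B) i :&: tnth (in_tuple B) j| == 2.

Definition hamiltonian (T : finType) (e : rel T) : Prop :=
  exists c : seq T, [/\ 3 <= size c, ucycle e c & forall x : T, x \in c].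

Lemma two_BIG_sym (V : finType) (B : seq {set V}) : symmetric (two_BIG (B := B)).
Proof. by move=> i j; rewrite /two_BIG setIC. Qed.

Lemma two_BIG_irr (v : nat) (V : finType) (B : seq {set V}) :
  is_TTS v B -> irreflexive (two_BIG (B := B)).
Proof. by case=> _ B3 _ i; rewrite /two_BIG setIid B3 // mem_tnth. Qed.

Arguments two_BIG {V} B.

(* Main.v *)
Require Import Defs.
From mathcomp Require Import all_boot all_algebra.
From mathcomp Require Import ring zify.

(* We use an explicit system on [Z_v x Z_3] plus a point at infinity, invariant
   under translation of [Z_v], whose blocks come in Hamiltonian order. For
   each level [i] and base point [x] a triangulated band winds between the
   levels [i] and [i + 1]; consecutive triangles share an edge, and since
   the vertices follow the quadratic sequence [x +- j^2], the translates of
   a band realise every nonzero difference within a level. Each band starts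
   next to a vertical triple [{x} x Z_3] and ends next to a triple through
   infinity. Joining three bands, three triples through infinity and one
   vertical triple gives a path from the vertical triple at [x] to the one
   at [x + 1], so [v] translates of it close up into a Hamilton cycle. *)

Set Implicit Arguments.
Unset Strict Implicit.
Unset Printing Implicit Defensive.

Import GRing.Theory.

(** * Triples, adjacency and double counting *)

Section Blocks.

Variable V : finType.
Implicit Types (a b c d : V) (s : seq {set V}).

Definition adjacent (b b' : {set V}) : bool := #|b :&: b'| == 2.

Lemma adjacentC : symmetric adjacent.
Proof. by move=> b b'; rewrite /adjacent setIC. Qed.

(** The vertices are positions, so enumerating them in order visits each exactly once, even when
    blocks repeat; only the adjacency of cyclically consecutive blocks remains to be checked. *)
Lemma hamiltonian_two_BIG s :
  3 <= size s -> cycle adjacent s -> hamiltonian (two_BIG s).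
Proof.
move=> s_ge3 cyc_s; exists (enum 'I_(size s)); split.
- by rewrite size_enum_ord.
- apply/andP; split; last exact: enum_uniq.
  suff def_s : [seq tnth (in_tuple s) i | i <- enum 'I_(size s)] = s.
    by rewrite -{1}def_s cycle_map in cyc_s.
  by rewrite -[RHS](map_tnth_enum (in_tuple s)).
- by move=> i; rewrite mem_enum.
Qed.

Definition tri a b c : {set V} := [set a; b; c].

Lemma triC a b c : tri a b c = tri b a c.
Proof. by rewrite /tri [[set a; b]]setUC. Qed.

Lemma tri_rot a b c : tri a b c = tri b c a.
Proof. by rewrite /tri setUC setUA setUC setUA setUC setUA. Qed.

Lemma card_tri a b c : uniq [:: a; b; c] -> #|tri a b c| = 3.
Proof.
rewrite /= !inE negb_or => /andP[/andP[ab ac] /andP[bc _]].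
by rewrite /tri setUC cardsU1 cards2 !inE ab negb_or eq_sym ac eq_sym bc.
Qed.

Lemma adjacent_tri a b c d :
  uniq [:: a; b; c; d] -> adjacent (tri a b c) (tri b c d).
Proof.
rewrite /= !inE !negb_or -!andbA => /and4P[ab ac ad /and4P[bc bd cd _]].
rewrite /adjacent (_ : _ :&: _ = [set b; c]) ?cards2 ?bc //.
apply/setP=> x; rewrite !inE.
case: (eqVneq x a) => [->|_].
  by rewrite (negPf ab) (negPf ac) (negPf ad).
by case: (x == b); case: (x == c).
Qed.

Lemma count_ge2 (p : pred {set V}) s (b b' : {set V}) :
  b \in s -> b' \in s -> b != b' -> p b -> p b' -> 2 <= count p s.
Proof.
move=> sb sb' neq pb pb'; rewrite -size_filter.
apply: (@uniq_leq_size _ [:: b; b']) => [|x]; first by rewrite /= inE neq.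
by rewrite !inE mem_filter => /orP[]/eqP->; rewrite ?pb ?pb' ?sb ?sb'.
Qed.

(* Double counting of the incidences between pairs and blocks: a covering with
   the right number of blocks is exact. *)
Lemma is_TTS_of_cover s :
    (forall b : {set V}, b \in s -> #|b| = 3) ->
    3 * size s = 2 * 'C(#|V|, 2) ->
    (forall p q, p != q ->
       2 <= count (fun b : {set V} => [set p; q] \subset b) s) ->
  is_TTS #|V| s.
Proof.
move=> s3 size_s cov; split=> // P /eqP P2.
pose cnt (Q : {set V}) := count (fun b : {set V} => Q \subset b) s.
have cov2 (Q : {set V}) : #|Q| == 2 -> 2 <= cnt Q ?= iff (2 == cnt Q).
  by move=> /cards2P[p [q [neq ->]]]; split=> //; apply: cov.
have := leqif_sum cov2.
have -> : \sum_(Q : {set V} | #|Q| == 2) 2 = 2 * 'C(#|V|, 2).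
  rewrite sum_nat_const mulnC -card_draws; congr (_ * _).
  by apply: eq_card => Q; rewrite inE.
have -> : \sum_(Q : {set V} | #|Q| == 2) cnt Q = 3 * size s.
  under eq_bigr => Q _ do rewrite /cnt -sum1_count big_mkcond.
  rewrite exchange_big /=.
  rewrite (eq_big_seq (fun=> 3)) => [|b sb].
    by rewrite big_const_seq count_predT iter_addn_0.
  rewrite -big_mkcondr /= sum1dep_card.
  rewrite -[RHS]/('C(3, 2)) -{1}(s3 b sb) -cards_draws.
  by apply: eq_card => Q; rewrite !inE andbC.
rewrite size_s => -[_ /esym]; rewrite eqxx => /forallP/(_ P).
by rewrite P2 => /eqP.
Qed.

End Blocks.

(** * Paths assembled from indexed families *)

Lemma path_map_iota (T : Type) (e : rel T) (f : nat -> T) k n :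
  (forall j, k <= j < k + n -> e (f j) (f j.+1)) ->
  path e (f k) (map f (iota k.+1 n)).
Proof.
elim: n k => //= n IHn k efS; rewrite efS ?leqnn -?addSnnS ?ltnS ?leq_addr //=.
by apply: IHn => j /andP[? ?]; apply: efS; lia.
Qed.

Lemma path_flatten_iota (T : Type) (e : rel T) (f : nat -> T)
    (g : nat -> seq T) k n :
    (forall j, path e (f j) (g j)) -> (forall j, last (f j) (g j) = f j.+1) ->
  let p := flatten (map g (iota k n)) in
  path e (f k) p /\ last (f k) p = f (k + n).
Proof.
move=> eg lg; elim: n k => [|n IHn] k /=; first by rewrite addn0.
by rewrite cat_path last_cat lg eg -addSnnS; apply: IHn.
Qed.

(** * The points, arithmetic in [Z_v], and the blocks *)

Section Construction.

Local Open Scope ring_scope.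

Variable n : nat.
Hypothesis odd_n : odd n.

(** Here [v] is [n.+2], a form for which the ordinals carry the ring structure of [Z_v]; [n] and [v]
    have the same parity. *)
Local Notation R := 'I_n.+2.
Local Notation V := (option ('I_3 * R)).
Implicit Types (i : 'I_3) (x y t d : R) (j : nat).

Definition pt i x : V := Some (i, x).

Lemma eq_pt i i' x x' : (pt i x == pt i' x') = (i == i') && (x == x').
Proof. by []. Qed.

Lemma ptP (p : V) : p = None \/ exists i x, p = pt i x.
Proof. by case: p => [[i x]|]; [right; exists i, x | left]. Qed.

Lemma level_cases i k : [\/ k = i, k = i + 1 | k = i + 1 + 1].
Proof.
by case: i k => [[|[|[|//]]] ?] [[|[|[|//]]] ?];
  do [apply: Or31; exact: val_inj | apply: Or32; exact: val_inj
     | apply: Or33; exact: val_inj].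
Qed.

Lemma level3 i : i + 1 + 1 + 1 = i.
Proof. by apply: val_inj; case: i => [[|[|[|//]]] ?]. Qed.

Lemma level_neq i :
  ((i == i + 1) = false) * ((i + 1 == i) = false) *
  ((i == i + 1 + 1) = false) * ((i + 1 + 1 == i) = false) *
  ((i + 1 == i + 1 + 1) = false) * ((i + 1 + 1 == i + 1) = false).
Proof. by case: i => [[|[|[|//]]] ?]. Qed.

Lemma natr_eq0 j : (j%:R == 0 :> R) = (n.+2 %| j)%N.
Proof. by rewrite Zp_nat -val_eqE. Qed.

Lemma natr_order : n.+2%:R = 0 :> R.
Proof. by apply/eqP; rewrite natr_eq0. Qed.

Lemma natr_orderB1 : n.+1%:R = -1 :> R.
Proof. by apply: (addIr 1); rewrite natr1 natr_order addNr. Qed.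

Lemma natr_orderB2 : n%:R = -2%:R :> R.
Proof. by apply: (addIr 1); rewrite natr1 natr_orderB1; ring. Qed.

(** For odd [n] this is [(v + 1) / 2], the inverse of 2 modulo [v]. *)
Definition half : R := n./2.+2%:R.

Lemma half2 : half + half = 1.
Proof.
have -> : half + half = (n.+2 + 1)%:R :> R.
  by rewrite -natrD; congr _%:R; have := odd_double_half n; rewrite odd_n; lia.
by rewrite natrD natr_order add0r.
Qed.

Lemma doubled_eq0 d : (d + d == 0) = (d == 0).
Proof.
apply/eqP/eqP=> [dd0|->]; last by rewrite addr0.
have -> : d = half * (d + d) by rewrite -[LHS]mul1r -half2; ring.
by rewrite dd0 mulr0.
Qed.

Lemma neq_subadd t d : d != 0 -> t - d != t + d.
Proof.
apply: contra => /eqP h; rewrite -doubled_eq0; apply/eqP.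
have -> : d + d = t + d - (t - d) by ring.
by rewrite h subrr.
Qed.

(* With signs -1, -1, 1 on the levels 0, 1, 2, the path of blocks that leaves
   the vertical triple at [x] comes back to the one at [x + 1]. *)
Definition sgn i : R := if i == 2%:R then 1 else -1.

Lemma sgn2 i : sgn i * sgn i = 1.
Proof. by rewrite /sgn; case: ifP => _; ring. Qed.

Lemma mul_sgn_eq0 i d : (sgn i * d == 0) = (d == 0).
Proof.
apply/eqP/eqP=> [sd0|->]; last by rewrite mulr0.
by rewrite -[d]mul1r -(sgn2 i) -mulrA sd0 mulr0.
Qed.

(* The vertices of a triangulated band that zigzags between the levels [i]
   (odd indices) and [i + 1] (even indices). *)
Definition zigzag i x j : V :=
  pt (if odd j then i else i + 1) (x + sgn i * ((odd j)%:R - j%:R * j%:R)).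

Definition band_block i x j : {set V} :=
  tri (zigzag i x j) (zigzag i x j.+1) (zigzag i x j.+2).

(** There are [v - 1] triangles, so that the middle index [j.+1] runs once through the nonzero
    residues. *)
Definition band i x : seq {set V} := map (band_block i x) (iota 0 n.+1).

Definition vert x : {set V} := tri (pt 0 x) (pt 1 x) (pt 2%:R x).

(** The two finite points form the last edge of [band i x]. *)
Definition cone i x : {set V} :=
  tri None (pt i (x + sgn i)) (pt (i + 1) (x - sgn i)).

(** The first two bands meet directly along an edge inside level 1; the third is traversed
    backwards, from its cone to the next vertical triple. *)
Definition segment x : seq {set V} :=
  band 1 x ++ band 0 (x - 1)
    ++ [:: cone 0 (x - 1); cone 1 (x + 1); cone 2%:R (x + 1)]
    ++ rcons (rev (band 2%:R (x + 1))) (vert (x + 1)).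

Definition blocks : seq {set V} :=
  flatten [seq segment j%:R | j <- iota 0 n.+2].

(** * Nondegeneracy and adjacency of the blocks *)

Lemma zigzag_neqS i x j k : odd j != odd k -> zigzag i x j != zigzag i x k.
Proof.
by rewrite /zigzag eq_pt; case: (odd j); case: (odd k) => //= _;
  rewrite level_neq.
Qed.

Lemma zigzag_neqSS i x j :
  (j <= n)%N -> zigzag i x j != zigzag i x j.+2.
Proof.
move=> j_le; rewrite /zigzag eq_pt /= negbK eqxx /=.
apply/eqP=> /addrI/eqP; rewrite -subr_eq0 -mulrBr mul_sgn_eq0.
(* Vertices two steps apart differ by [4(j + 1)] up to sign, which is nonzero because [v] is odd and
   [0 < j + 1 < v]. *)
have -> : (odd j)%:R - j%:R * j%:R - ((odd j)%:R - j.+2%:R * j.+2%:R)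
   = (j.+1%:R + j.+1%:R) + (j.+1%:R + j.+1%:R) :> R by ring.
by rewrite !doubled_eq0 natr_eq0 gtnNdvd.
Qed.

Lemma card_band_block i x j : (j <= n)%N -> #|band_block i x j| = 3.
Proof.
move=> j_le; apply: card_tri; rewrite /= !inE negb_or zigzag_neqSS //.
by rewrite !zigzag_neqS //=; case: odd.
Qed.

Lemma vertE i x : vert x = tri (pt i x) (pt (i + 1) x) (pt (i + 1 + 1) x).
Proof.
have P (k l : 'I_3) : k = l :> nat -> k = l by exact: val_inj.
case: i => [[|[|[|//]]] ?].
- by congr tri; congr pt; exact: P.
- by rewrite /vert tri_rot; congr tri; congr pt; exact: P.
- by rewrite /vert -tri_rot; congr tri; congr pt; exact: P.
Qed.

Lemma card_vert x : #|vert x| = 3.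
Proof. by apply: card_tri; rewrite /= ?inE ?eq_pt. Qed.

Lemma card_cone i x : #|cone i x| = 3.
Proof. by apply: card_tri; rewrite /= ?inE ?eq_pt level_neq. Qed.

Lemma adjacent_band_block i x j :
  (j < n)%N -> adjacent (band_block i x j) (band_block i x j.+1).
Proof.
move=> j_lt; apply: adjacent_tri; rewrite /= !inE !negb_or.
rewrite (zigzag_neqSS i x (ltnW j_lt)) (zigzag_neqSS i x j_lt).
by rewrite !zigzag_neqS //=; case: odd.
Qed.

Lemma adjacent_vert_band i x : adjacent (vert x) (band_block i x 0).
Proof.
have -> : vert x = tri (pt (i + 1 + 1) x) (zigzag i x 0) (zigzag i x 1).
  rewrite (vertE i) triC -tri_rot /zigzag /=.
  by rewrite !(subrr, mulr1, mulr0, addr0).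
apply: adjacent_tri; rewrite /= !inE !negb_or zigzag_neqSS //.
by rewrite !zigzag_neqS // !eq_pt !level_neq.
Qed.

(** The final indices [v - 1] and [v] are even and odd, and their squares are 1 and 0 modulo [v]. *)
Lemma zigzag_orderB1 i x : zigzag i x n.+1 = pt (i + 1) (x - sgn i).
Proof. by rewrite /zigzag /= odd_n natr_orderB1; congr pt => /=; ring. Qed.

Lemma zigzag_order i x : zigzag i x n.+2 = pt i (x + sgn i).
Proof. by rewrite /zigzag /= odd_n natr_order; congr pt => /=; ring. Qed.

Lemma adjacent_band_cone i x : adjacent (band_block i x n) (cone i x).
Proof.
rewrite /cone tri_rot triC -zigzag_order -zigzag_orderB1.
apply: adjacent_tri; rewrite /= !inE !negb_or zigzag_neqSS //.
by rewrite !zigzag_neqS //=; case: odd.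
Qed.

(** The shared edge joins the points [x - 1] and [x + 3] of level 1. The signs at levels 0 and 1
    make the two ends fit, and the points differ since 4 is invertible. *)
Lemma adjacent_band_band x :
  adjacent (band_block 1 x n) (band_block 0 (x - 1) 0).
Proof.
rewrite /band_block zigzag_orderB1 zigzag_order.
have -> : zigzag 1 x n = pt 1 (x + 3%:R).
  by rewrite /zigzag odd_n natr_orderB2 /sgn /=; congr pt; ring.
have -> : zigzag 0 (x - 1) 0 = pt 1 (x - 1).
  by rewrite /zigzag /sgn /= add0r; congr pt; ring.
have -> : zigzag 0 (x - 1) 1 = pt 0 (x - 1).
  by rewrite /zigzag /=; congr pt; ring.
have -> : zigzag 0 (x - 1) 2 = pt 1 (x + 3%:R).
  by rewrite /zigzag /= /sgn /= add0r; congr pt; ring.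
rewrite triC -(tri_rot (pt 1 (x + 3%:R)) (pt 1 (x - 1)) (pt 0 (x - 1))).
apply: adjacent_tri; rewrite /= !inE !eq_pt /= ?eqxx /= orbF andbT.
apply/eqP=> /addrI/eqP; rewrite -subr_eq0 opprK.
have -> : 3%:R + 1 = (1 + 1) + (1 + 1) :> R by ring.
by rewrite !doubled_eq0.
Qed.

Lemma adjacent_cone01 x : adjacent (cone 0 (x - 1)) (cone 1 (x + 1)).
Proof.
rewrite /cone triC.
have -> : pt (0 + 1) (x - 1 - sgn 0) = pt 1 x.
  by rewrite add0r /sgn /=; congr pt; ring.
have -> : pt 1 (x + 1 + sgn 1) = pt 1 x by rewrite /sgn /=; congr pt; ring.
by apply: adjacent_tri.
Qed.

Lemma adjacent_cone12 x : adjacent (cone 1 (x + 1)) (cone 2%:R (x + 1)).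
Proof.
rewrite /cone triC.
have -> : pt (1 + 1) (x + 1 - sgn 1) = pt 2%:R (x + 2%:R).
  by rewrite /sgn /=; congr pt; ring.
have -> : pt 2%:R (x + 1 + sgn 2%:R) = pt 2%:R (x + 2%:R).
  by rewrite /sgn /=; congr pt; ring.
by apply: adjacent_tri.
Qed.

(** * The Hamilton cycle *)

Lemma last_band i x b : last b (band i x) = band_block i x n.
Proof.
have E : iota 0 n.+1 = iota 0 n ++ [:: n].
  by rewrite -{2}[n]add0n -(iotaD 0 n 1) addn1.
rewrite /band E.
by rewrite map_cat last_cat.
Qed.

Lemma path_band i x b :
  adjacent b (band_block i x 0) -> path (@adjacent V) b (band i x).
Proof.
move=> adj_b; rewrite /band /= adj_b path_map_iota // => j /andP[_ j_lt].
exact: adjacent_band_block.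
Qed.

Lemma path_rev_band i x :
  path (@adjacent V) (cone i x) (rcons (rev (band i x)) (vert x)).
Proof.
have := rev_path (@adjacent V) (vert x) (rcons (band i x) (cone i x)).
rewrite last_rcons belast_rcons rev_cons => ->.
rewrite (eq_path (e' := @adjacent V)); last by move=> b b'; exact: adjacentC.
rewrite rcons_path path_band ?last_band; last exact: adjacent_vert_band.
exact: adjacent_band_cone.
Qed.

Lemma path_segment x : path (@adjacent V) (vert x) (segment x).
Proof.
rewrite /segment !cat_path !last_band !path_band /=.
- by rewrite adjacent_band_cone adjacent_cone01 adjacent_cone12 path_rev_band.
- exact: adjacent_band_band.
- exact: adjacent_vert_band.
Qed.

Lemma last_segment x b : last b (segment x) = vert (x + 1).
Proof. by rewrite /segment !last_cat /= last_rcons. Qed.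

Lemma cycle_blocks : cycle (@adjacent V) blocks.
Proof.
have [] := @path_flatten_iota _ (@adjacent V) (fun j => vert j%:R)
  (fun j => segment j%:R) 0 n.+2.
- by move=> j; exact: path_segment.
- by move=> j; rewrite last_segment natr1.
(* Since [v] is 0 in [R], the path starting at [vert 0] also ends there, so it closes up. *)
by rewrite add0n natr_order (cycle_path (vert 0)) -/blocks => ? ->.
Qed.

(** * Number and membership of the blocks *)

Lemma size_blocks : size blocks = (n.+2 * (3 * n.+2 + 1))%N.
Proof.
rewrite size_flatten /shape -map_comp.
(* A segment has three bands of [v - 1] triangles, three cones and one vertical triple. *)
rewrite (eq_map (g := fun=> (3 * n.+2 + 1)%N)); last first.
  move=> j; rewrite -[LHS]/(size (segment j%:R)) /segment.
  rewrite !size_cat size_rcons size_rev /band !size_map size_iota.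
  by rewrite -[size _]/3%N; lia.
by rewrite sumnE big_map big_const_seq count_predT size_iota iter_addn_0 mulnC.
Qed.

Lemma mem_segment x b :
  b \in segment x =
    [|| b \in band 1 x, b \in band 0 (x - 1), b == cone 0 (x - 1),
        b == cone 1 (x + 1), b == cone 2%:R (x + 1), b == vert (x + 1)
      | b \in band 2%:R (x + 1)].
Proof.
rewrite 3!mem_cat [_ \in [:: cone 0 _; _; _]]mem_seq3.
by rewrite mem_rcons (in_cons (vert (x + 1))) mem_rev -!orbA.
Qed.

Lemma card_blocks b : b \in blocks -> #|b| = 3.
Proof.
have band3 i x b' : b' \in band i x -> #|b'| = 3.
  case/mapP=> j; rewrite mem_iota => /andP[_ j_le] ->.
  exact: card_band_block.
case/flatten_mapP=> j _; rewrite mem_segment.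
case/or4P=> [/band3 //|/band3 //|/eqP->|]; first exact: card_cone.
by case/or4P=> [/eqP->|/eqP->|/eqP->|/band3 //]; rewrite ?card_cone ?card_vert.
Qed.

Lemma mem_blocks_segment x b : b \in segment x -> b \in blocks.
Proof.
move=> sb; apply/flatten_mapP; exists (nat_of_ord x); last by rewrite natr_Zp.
by rewrite mem_iota ltn_ord.
Qed.

Lemma vert_in_blocks x : vert x \in blocks.
Proof.
apply: (@mem_blocks_segment (x - 1)).
by rewrite mem_segment subrK eqxx !orbT.
Qed.

Lemma cone_in_blocks i x : cone i x \in blocks.
Proof.
have [->|->|->] := level_cases 0 i.
- apply: (@mem_blocks_segment (x + 1)).
  by rewrite mem_segment addrK eqxx !orbT.
- apply: (@mem_blocks_segment (x - 1)).
  by rewrite mem_segment add0r subrK eqxx !orbT.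
- apply: (@mem_blocks_segment (x - 1)).
  by rewrite mem_segment add0r subrK eqxx !orbT.
Qed.

Lemma band_in_blocks i x j : (j <= n)%N -> band_block i x j \in blocks.
Proof.
move=> j_le.
have bj : band_block i x j \in band i x by rewrite map_f // mem_iota.
have [i0|i0|i0] := level_cases 0 i; move: bj; rewrite i0 ?add0r => bj.
- apply: (@mem_blocks_segment (x + 1)).
  by rewrite mem_segment addrK bj !orbT.
- by apply: (@mem_blocks_segment x); rewrite mem_segment bj.
- apply: (@mem_blocks_segment (x - 1)).
  by rewrite mem_segment subrK bj !orbT.
Qed.

(** * Every pair of points lies in two blocks *)

Lemma natr_parity (p : bool) d : d != 0 ->
  exists j, [/\ (j <= n)%N, odd j = p & j.+1%:R = d \/ j.+1%:R = - d].
Proof.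
move=> d0; have d_gt0 : (0 < d)%N by rewrite lt0n.
have d_lt := ltn_ord d.
(* As [v] is odd, [d] and [v - d] have opposite parities, so one of them is [j.+1] with [j] of
   parity [p]. *)
have [odd_d|odd_d] := boolP (odd d == ~~ p).
  exists (nat_of_ord d).-1; rewrite prednK // natr_Zp; split; last by left.
    by lia.
  by move/eqP: odd_d; rewrite -{1}(prednK d_gt0) /=; case: odd p => [] [].
exists (n.+2 - d).-1%N; have dlt : (0 < n.+2 - d)%N by rewrite subn_gt0.
have Ed : (n.+2 - d)%:R = - d.
  apply: (addIr (d : nat)%:R); rewrite -natrD subnK 1?ltnW // natr_Zp addNr.
  exact: natr_order.
rewrite prednK // Ed; split; last by right.
  by lia.
have: odd (n.+2 - d) = ~~ odd d by rewrite oddB 1?ltnW //= odd_n.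
rewrite -{1}(prednK dlt) /=; move: odd_d.
by case: (odd d) p; case: odd => [] [].
Qed.

(** Band triangles described by the midpoint [t] of their horizontal edge and its half-difference
    [d]: odd [j] gives [up_block], even [j] gives [down_block]. With [e = j.+1], the squares of
    [e - 1] and [e + 1] lie at distance [2e] on either side of [e^2 + 1], hence [d] is [2e] up to
    sign. *)
Definition up_block i t d : {set V} :=
  tri (pt i (t - d)) (pt i (t + d)) (pt (i + 1) t).

Definition down_block i t d : {set V} :=
  tri (pt (i + 1) (t - d)) (pt (i + 1) (t + d)) (pt i (t + (sgn i + sgn i))).

Lemma up_blockN i t d : up_block i t (- d) = up_block i t d.
Proof. by rewrite /up_block opprK triC. Qed.

Lemma down_blockN i t d : down_block i t (- d) = down_block i t d.
Proof. by rewrite /down_block opprK triC. Qed.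

Lemma up_block_band i t j (e := j.+1%:R : R) : odd j ->
  up_block i t (sgn i * (e + e)) = band_block i (t + sgn i * (e * e)) j.
Proof.
move=> odd_j; rewrite /up_block /band_block /zigzag /= odd_j /=.
have -> : j.+2%:R = e + 1 :> R by rewrite natr1.
have -> : j%:R = e - 1 :> R by rewrite /e -natr1 addrK.
rewrite -[j.+1%:R]/e [LHS]tri_rot.
by congr tri; congr pt; ring.
Qed.

Lemma down_block_band i t j (e := j.+1%:R : R) : ~~ odd j ->
  down_block i t (sgn i * (e + e)) = band_block i (t + sgn i * (e * e + 1)) j.
Proof.
move=> odd_j; rewrite /down_block /band_block /zigzag /= odd_j (negPf odd_j) /=.
have -> : j.+2%:R = e + 1 :> R by rewrite natr1.
have -> : j%:R = e - 1 :> R by rewrite /e -natr1 addrK.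
rewrite -[j.+1%:R]/e [LHS]tri_rot.
by congr tri; congr pt; ring.
Qed.

(** Brings an arbitrary nonzero half-difference into the form taken by the bands. *)
Lemma halve_sgn i d : d != 0 ->
  exists2 d', d' != 0 & d = sgn i * (d' + d').
Proof.
move=> d0; have E : d = sgn i * (sgn i * half * d + sgn i * half * d).
  have -> : sgn i * (sgn i * half * d + sgn i * half * d)
    = (sgn i * sgn i) * (half + half) * d by ring.
  by rewrite sgn2 half2 !mul1r.
exists (sgn i * half * d) => //.
by apply: contra d0 => /eqP h; rewrite E h addr0 mulr0.
Qed.

Lemma up_in_blocks i t d : d != 0 -> up_block i t d \in blocks.
Proof.
case/(halve_sgn i)=> {}d d0 ->.
have [j [j_le odd_j [<-|E]]] := natr_parity true d0.
  by rewrite up_block_band ?odd_j // band_in_blocks.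
have -> : d = - j.+1%:R by rewrite E opprK.
by rewrite -opprD mulrN up_blockN up_block_band ?odd_j // band_in_blocks.
Qed.

Lemma down_in_blocks i t d : d != 0 -> down_block i t d \in blocks.
Proof.
case/(halve_sgn i)=> {}d d0 ->.
have [j [j_le odd_j [<-|E]]] := natr_parity false d0.
  by rewrite down_block_band ?odd_j // band_in_blocks.
have -> : d = - j.+1%:R by rewrite E opprK.
by rewrite -opprD mulrN down_blockN down_block_band ?odd_j // band_in_blocks.
Qed.

Lemma neq_memP (b b' : {set V}) p : p \in b -> p \notin b' -> b != b'.
Proof. by move=> pb; apply: contra => /eqP <-. Qed.

Definition covered_twice (p q : V) : bool :=
  (2 <= count (fun b : {set V} => [set p; q] \subset b) blocks)%N.

Lemma covered_twiceC p q : covered_twice p q = covered_twice q p.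
Proof. by rewrite /covered_twice setUC. Qed.

Lemma covered_twiceP b b' p q : b \in blocks -> b' \in blocks -> b != b' ->
    (p \in b) && (q \in b) -> (p \in b') && (q \in b') ->
  covered_twice p q.
Proof.
by move=> ? ? neq ? ?; apply: count_ge2 neq _ _ => //; rewrite subUset !sub1set.
Qed.

(** Each finite point is on one cone towards the level above and one from the level below, which is
    [i + 1 + 1]. *)
Lemma covered_apex i x : covered_twice None (pt i x).
Proof.
apply: (covered_twiceP (cone_in_blocks i (x - sgn i))
  (cone_in_blocks (i + 1 + 1) (x + sgn (i + 1 + 1)))).
- apply: (neq_memP (p := pt (i + 1) (x - sgn i - sgn i))).
    by rewrite !inE eqxx orbT.
  by rewrite !inE !eq_pt level3 !level_neq.
- by rewrite !inE subrK !eqxx orbT.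
- by rewrite !inE level3 addrK !eqxx !orbT.
Qed.

(** The pair is the horizontal edge of an up block with apex on the level above and of a down block
    with apex on the level below. *)
Lemma covered_level i x y : x != y -> covered_twice (pt i x) (pt i y).
Proof.
move=> neq; pose t := half * (x + y); pose d := half * (y - x).
have Ex : x = t - d.
  have -> : t - d = (half + half) * x by rewrite /t /d; ring.
  by rewrite half2 mul1r.
have Ey : y = t + d.
  have -> : t + d = (half + half) * y by rewrite /t /d; ring.
  by rewrite half2 mul1r.
have d0 : d != 0 by apply: contra neq => /eqP d0; rewrite Ex Ey d0 subr0 addr0.
apply: (covered_twiceP (up_in_blocks i t d0)
  (down_in_blocks (i + 1 + 1) t d0)).
- apply: (neq_memP (p := pt (i + 1) t)); first by rewrite !inE eqxx !orbT.
  by rewrite !inE !eq_pt level3 !level_neq.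
- by rewrite !inE Ex Ey !eqxx orbT.
- by rewrite !inE level3 Ex Ey !eqxx !orbT.
Qed.

(** Generically the pair lies in an up block with midpoint [y] and a down block with midpoint
    [x - s]. The first degenerates when [y = x], where [vert x] replaces it; the second when
    [y = x - s], where a cone replaces it. *)
Lemma covered_mixed i x y : covered_twice (pt i x) (pt (i + 1) y).
Proof.
pose s := sgn i + sgn i.
have memB z : (pt i x \in down_block i (x - s) z) &&
              (pt (i + 1) (x - s + z) \in down_block i (x - s) z).
  by rewrite !inE subrK !eqxx !orbT.
have memC : (pt i x \in cone i (x - sgn i)) &&
            (pt (i + 1) (x - s) \in cone i (x - sgn i)).
  by rewrite !inE subrK opprD addrA !eqxx !orbT.
have -> : y = x - s + (y - x + s) by ring.
have [d0|d0] := eqVneq (y - x) 0.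
  have -> : x - s + (y - x + s) = x by rewrite d0; ring.
  have memV : (pt i x \in vert x) && (pt (i + 1) x \in vert x).
    by rewrite (vertE i) !inE !eqxx !orbT.
  have [s0|s0] := eqVneq s 0.
    apply: (covered_twiceP (vert_in_blocks x) (cone_in_blocks i (x - sgn i))).
    - by rewrite eq_sym; apply: (neq_memP (p := None)); rewrite !inE.
    - by [].
    - by move: memC; rewrite s0 subr0.
  apply: (covered_twiceP (vert_in_blocks x) (down_in_blocks i (x - s) s0)).
  - apply: (neq_memP (p := pt (i + 1 + 1) x)).
      by rewrite (vertE i) !inE eqxx !orbT.
    by rewrite !inE !eq_pt !level_neq.
  - by [].
  - by have := memB s; rewrite subrK.
have memA : (pt i x \in up_block i y (y - x)) &&
            (pt (i + 1) y \in up_block i y (y - x)).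
  by rewrite !inE subKr !eqxx !orbT.
have Ey : x - s + (y - x + s) = y by ring.
have [s0|s0] := eqVneq (y - x + s) 0.
  apply: (covered_twiceP (up_in_blocks i y d0)
    (cone_in_blocks i (x - sgn i))).
  - by rewrite eq_sym; apply: (neq_memP (p := None)); rewrite !inE.
  - by rewrite Ey.
  - by rewrite s0 addr0.
apply: (covered_twiceP (up_in_blocks i y d0) (down_in_blocks i (x - s) s0)).
(* The up block has a second point on level [i], while the down block meets that level only in
   [pt i x]. *)
- apply: (neq_memP (p := pt i (y + (y - x)))).
    by rewrite !inE eqxx !orbT.
  rewrite !inE !eq_pt !level_neq /= eqxx subrK /= eq_sym.
  by rewrite -{1}[x](subKr y) neq_subadd.
- by rewrite Ey.
- exact: memB.
Qed.

Lemma covered_pair p q : p != q -> covered_twice p q.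
Proof.
have [->|[i [x ->]]] := ptP p; have [->|[k [y ->]]] := ptP q => //.
- by rewrite covered_apex.
- by rewrite covered_twiceC covered_apex.
have [->|->|->] := level_cases i k; rewrite eq_pt ?eqxx.
- exact: covered_level.
- by rewrite covered_mixed.
- rewrite covered_twiceC; have := covered_mixed (i + 1 + 1) y x.
  by rewrite level3.
Qed.

Lemma is_TTS_blocks : is_TTS (3 * n.+2 + 1) blocks.
Proof.
have cardV : #|{: V}| = (3 * n.+2 + 1)%N.
  by rewrite card_option card_prod !card_ord addn1.
rewrite -cardV; apply: is_TTS_of_cover => [b||]; first exact: card_blocks.
  (* Both sides equal [3v(3v + 1)]. *)
  by rewrite size_blocks cardV -mul_bin_diag bin1 addn1 /=; lia.
exact: covered_pair.
Qed.

End Construction.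

Theorem theorem7p1 (v : nat) (v_ge7 : 7 <= v) (v_odd : odd v) :
  (exists (V : finType) (B : seq {set V}),
      is_TTS v B /\ hamiltonian (two_BIG B)) ->
  exists (V : finType) (B : seq {set V}),
      is_TTS (3 * v + 1) B /\ hamiltonian (two_BIG B).
Proof.
case: v v_ge7 v_odd => [//|[//|n]] n_ge odd_n _.
have {}odd_n : odd n by move: odd_n; rewrite /= negbK.
exists (option ('I_3 * 'I_n.+2)), (blocks n); split.
  exact: is_TTS_blocks.
apply: hamiltonian_two_BIG; last exact: cycle_blocks.
by rewrite size_blocks; lia.
Qed.
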